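(* Let $1 \leq k<\ell$ be integers and let $\varepsilon>0$. If an $n$-vertex graph $G$ is $\varepsilon$-far from $C_{2k+1}$-free, then $G$ contains at least $(c_\ell\, \varepsilon^{4\ell+2})\, n^{2\ell+1}$ copies of $C_{2\ell+1}$, where $c_\ell>0$ is a constant depending only on $\ell$.
   Context: $C_s$ denotes the cycle of length $s$. An $n$-vertex graph $G$ is $\varepsilon$-far from satisfying a graph property $\mathcal P$ if one must add or delete at least $\varepsilon n^2$ edges of $G$ in order to create a graph satisfying $\mathcal P$; here $\mathcal P$ is the property of being $C_{2k+1}$-free, i.e. of containing no cycle of length $2k+1$ as a subgraph. A copy of $C_s$ in $G$ is a (not necessarily induced) subgraph of $G$ isomorphic to $C_s$.
   Formalization: The claim is proved for all n at least some n_0 depending on k, ℓ and ε; for every n it is false: the triangle (k=1, ℓ=2, ε=1/9, n=3) is ε-far from C_3-free but contains no C_5. *)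

(* Defs.v *)
From HB Require Import structures.
From mathcomp Require Import all_boot all_order all_algebra.
From mathcomp Require Import reals.

Set Implicit Arguments.
Unset Strict Implicit.
Unset Printing Implicit Defensive.

Import Order.TTheory GRing.Theory Num.Theory.

Record sgraph (T : finType) := SGraph {
  adj :> rel T;
  adj_sym : symmetric adj;
  adj_irrefl : irreflexive adj }.

Definition edges (T : finType) (G : sgraph T) : {set {set T}} :=
  [set [set p.1; p.2] | p : T * T & adj G p.1 p.2].

Definition edit_distance (T : finType) (G H : sgraph T) : nat :=
  #|(edges G :\: edges H) :|: (edges H :\: edges G)|.

(* A pair (vertex set, edge set), not necessarily induced. *)
Definition is_subgraph (T : finType) (S : {set T} * {set {set T}})
    (G : sgraph T) : bool :=
  (S.2 \subset edges G) && [forall e in S.2, e \subset S.1].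

Definition is_iso_to (T U : finType) (H : sgraph U)
    (S : {set T} * {set {set T}}) : bool :=
  [exists f : {ffun U -> T},
    [&& injectiveb f, f @: [set: U] == S.1
      & [set f @: (e : {set U}) | e in edges H] == S.2]].

(* Copies are unlabelled: two embeddings with the same image give one copy. *)
Definition copies (T U : finType) (H : sgraph U) (G : sgraph T) :
    {set {set T} * {set {set T}}} :=
  [set S | is_subgraph S G && is_iso_to H S].

(* [ordS] is the cyclic successor on 'I_s; the conjunct [i != j] only
   matters for the degenerate case s = 1. *)
Definition cycle_adj (s : nat) : rel 'I_s :=
  fun i j => (i != j) && ((j == ordS i) || (i == ordS j)).

Lemma cycle_adj_sym s : symmetric (@cycle_adj s).
Proof. by move=> i j; rewrite /cycle_adj eq_sym orbC. Qed.

Lemma cycle_adj_irrefl s : irreflexive (@cycle_adj s).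
Proof. by move=> i; rewrite /cycle_adj eqxx. Qed.

Definition cycle_graph (s : nat) : sgraph 'I_s :=
  SGraph (@cycle_adj_sym s) (@cycle_adj_irrefl s).

Definition cycle_free (s : nat) (T : finType) (G : sgraph T) : Prop :=
  copies (cycle_graph s) G = set0.

Local Open Scope ring_scope.

Definition is_far (R : realType) (eps : R) (T : finType)
    (P : sgraph T -> Prop) (G : sgraph T) : Prop :=
  forall H : sgraph T, P H -> eps * #|T|%:R ^+ 2 <= (edit_distance G H)%:R.

(* Main.v *)
(* After discarding the degenerate ones, closed walks of length 2l+1 stand for
   copies of C_{2l+1}: each copy comes from boundedly many walks and only
   O(n^(2l)) closed walks repeat a vertex.

   Put K = l-1 and suppose that few vertices start many closed walks. Cover
   almost all vertices by the neighbourhoods N(p) of O(1/eps) vertices p that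
   start few of them, and let L_0(p) = N(p) and L_{j+1}(p) be the set of
   vertices with at least a neighbours in L_j(p), where a ~ eps^2 n. Delete the
   edges at exceptional or uncovered vertices, the edges from L_j(p) leaving
   L_{j+1}(p), and the edges inside L_K(p). An edge inside L_K(p) extends to
   a^(2K) closed walks of length 2l+1 at p, so altogether fewer than eps n^2
   edges are deleted. But in what remains, a cycle x_0 ... x_{2k} with k <= K
   starts in some L_0(p), hence x_k and x_{k+1} both lie in L_k(p); stepping
   back and forth along the edge x_k x_{k+1} puts both in L_K(p), a
   contradiction. *)
Require Import Defs.
From HB Require Import structures.
From mathcomp Require Import all_boot all_order all_algebra.
From mathcomp Require Import reals zify ring lra.

Set Implicit Arguments.
Unset Strict Implicit.
Unset Printing Implicit Defensive.

Import Order.TTheory GRing.Theory Num.Theory.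
Local Open Scope ring_scope.

(** Bounds the non-injective maps from [s] points to [n] points by [s ^ 2 * n ^ (s - 1)]; the extra
    factor [n] avoids the truncated exponent. *)
Lemma ffact_lower n s : (n * n ^ s <= n * n ^_ s + s * s * n ^ s)%N.
Proof.
elim: s => [|s IHs]; first by rewrite ffactn0 expn0 addn0.
have le_ffact : (n ^_ s <= n ^ s)%N.
  elim: s {IHs} => // s IHs; rewrite ffactnSr expnSr.
  by rewrite leq_mul // leq_subr.
have le_step : (n * n ^_ s <= n ^_ s.+1 + s * n ^ s)%N.
  rewrite ffactnSr mulnBr.
  apply: leq_trans (_ : n ^_ s * n - n ^_ s * s + n ^_ s * s <= _)%N.
    by rewrite addnC -maxnE mulnC leq_maxr.
  by rewrite leq_add2l mulnC leq_mul2l le_ffact orbT.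
rewrite expnS.
apply: (@leq_trans (n * (n ^_ s.+1 + s * n ^ s + s * s * n ^ s))%N).
  by rewrite leq_mul2l (leq_trans IHs) ?orbT // leq_add2r.
rewrite -addnA !mulnDr leq_add2l.
rewrite !(mulnCA n) -mulnDl leq_mul2r; apply/orP; right.
by rewrite mulSn mulnS; lia.
Qed.

(** * Closed walks and homomorphisms of a cycle *)

Section ClosedWalks.

Variables (T : finType) (G : sgraph T).

Definition nbhd (x : T) : {set T} := [set y | G x y].

(** The tuple omits the base point [p], so these walks have [m.+1] edges. *)
Definition closed_walks (m : nat) (p : T) : {set m.-tuple T} :=
  [set t : m.-tuple T | cycle G (p :: t)].

Definition cycle_homs (s : nat) : {set {ffun 'I_s -> T}} :=
  [set f : {ffun 'I_s -> T} | [forall i, G (f i) (f (ordS i))]].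

Lemma sum_closed_walks m :
  (\sum_p #|closed_walks m p| <= #|cycle_homs m.+1|)%N.
Proof.
pose A := [set q : T * m.-tuple T | cycle G (q.1 :: q.2)].
have -> : (\sum_p #|closed_walks m p| = #|A|)%N.
  under eq_bigr => p _ do rewrite -sum1_card.
  rewrite pair_big_dep /= -sum1_card; apply: eq_bigl => -[p t].
  by rewrite !inE.
pose F (q : T * m.-tuple T) : {ffun 'I_m.+1 -> T} :=
  [ffun i => tnth (cons_tuple q.1 q.2) i].
have F_inj : injective F.
  move=> [p t] [p' t'] /ffunP eqF.
  have /(congr1 val) [-> /val_inj -> //] : cons_tuple p t = cons_tuple p' t'.
  by apply: eq_from_tnth => i; have := eqF i; rewrite !ffunE.
rewrite -(card_imset A F_inj); apply/subset_leq_card/subsetP => f.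
case/imsetP=> -[p t]; rewrite inE /= => /(pathP p) walk ->.
rewrite inE; apply/forallP => i; rewrite !ffunE !(tnth_nth p) /=.
have := walk i; rewrite size_rcons size_tuple => /(_ (ltn_ord i)).
rewrite -rcons_cons nth_rcons /= size_tuple ltn_ord nth_rcons size_tuple.
rewrite if_same; case: ltnP => [lt_im|le_mi]; first by rewrite modn_small.
have -> : (i : nat) = m by apply/eqP; rewrite eqn_leq le_mi -ltnS ltn_ord.
by rewrite modnn.
Qed.

End ClosedWalks.

(** * From homomorphisms to unlabelled copies *)

Section Copies.

Variables (T : finType) (G : sgraph T).

Lemma edges_pair (U : finType) (K : sgraph U) x y :
  ([set x; y] \in edges K) = K x y.
Proof.
apply/imsetP/idP => [[[u v]] /= Kuv eq_xy|Kxy]; last first.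
  by exists (x, y); rewrite ?inE.
rewrite inE /= in Kuv.
have neq_uv : u != v by apply: contraTneq Kuv => ->; rewrite adj_irrefl.
have /set2P[eq_x|eq_x] : x \in [set u; v] by rewrite -eq_xy set21.
- have /set2P[eq_v|<-] : v \in [set x; y] by rewrite eq_xy set22.
    by rewrite eq_v eq_x eqxx in neq_uv.
  by rewrite eq_x.
- have /set2P[eq_u|<-] : u \in [set x; y] by rewrite eq_xy set21.
    by rewrite eq_u eq_x eqxx in neq_uv.
  by rewrite adj_sym eq_x.
Qed.

Definition image_copy (s : nat) (f : {ffun 'I_s -> T}) :
    {set T} * {set {set T}} :=
  (f @: setT, [set f @: (e : {set 'I_s}) | e in edges (cycle_graph s)]).

Lemma image_copyP s (f : {ffun 'I_s -> T}) :
  f \in cycle_homs G s -> injectiveb f ->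
  image_copy f \in copies (cycle_graph s) G.
Proof.
rewrite inE => /forallP hom_f inj_f; rewrite inE; apply/andP; split; last first.
  by apply/existsP; exists f; rewrite inj_f !eqxx.
apply/andP; split; last first.
  apply/'forall_implyP => _ /imsetP[e _ ->].
  by rewrite imsetS // subsetT.
apply/subsetP => _ /imsetP[_ /imsetP[[i j] /= ij ->] ->].
rewrite imsetU1 imset_set1 edges_pair.
move: ij; rewrite inE /= => /andP[_ /orP[] /eqP ->]; first exact: hom_f.
by rewrite adj_sym; apply: hom_f.
Qed.

(** The additive form avoids subtraction: at most [#|T| ^ s - #|T| ^_ s] homomorphisms are
    non-injective. An injective one with image copy [S] maps into the at most [s] vertices of [S],
    so each copy arises from at most [s ^ s] of them. *)
Lemma card_hom_le_copies s :
  (#|cycle_homs G s| + #|T| ^_ s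
    <= #|copies (cycle_graph s) G| * s ^ s + #|T| ^ s)%N.
Proof.
pose I := [set f : {ffun 'I_s -> T} | injectiveb f].
have cardI : #|I| = (#|T| ^_ s)%N by rewrite card_inj_ffuns card_ord.
have cardT : (#|I| + #|~: I| = #|T| ^ s)%N.
  by rewrite cardsC card_ffun card_ord.
rewrite -cardI -cardT -(cardsID I (cycle_homs G s)).
suff le_inj : (#|cycle_homs G s :&: I|
    <= #|copies (cycle_graph s) G| * s ^ s)%N.
  have : (#|cycle_homs G s :\: I| <= #|~: I|)%N.
    by apply/subset_leq_card; rewrite setDE subsetIr.
  move: le_inj; set a := #|_|; set b := #|_|; set c := #|_|; set d := #|_|.
  by lia.
rewrite -sum1_card (partition_big (@image_copy s)
  (mem (copies (cycle_graph s) G))) /=; last first.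
  by move=> f /setIP[hom_f]; rewrite inE; apply: image_copyP.
rewrite -sum_nat_const; apply: leq_sum => S.
rewrite inE => /andP[_ /existsP[g /and3P[_ /eqP S1 _]]].
apply: (@leq_trans #|@ffun_on 'I_s (mem S.1)|).
  rewrite sum1_card; apply/subset_leq_card/subsetP => f.
  rewrite unfold_in => /andP[_ /eqP <-]; apply/ffun_onP => i /=.
  exact: imset_f.
rewrite card_ffun_on card_ord.
have le_S1 : (#|mem S.1| <= s)%N.
  by rewrite -S1 (leq_trans (leq_imset_card _ _)) // cardsT card_ord.
by move: le_S1; case: (s) => [|s'] le_S1; rewrite ?expn0 ?leq_exp2r.
Qed.

(** The walk runs round the cycle periodically, so adjacency has no boundary case. It is claimed
    only for [0 < k], since for [k = 0] the cycle is a lone vertex without edges. *)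
Lemma not_cycle_free_walk k : ~ cycle_free (2 * k + 1) G ->
  exists x : nat -> T,
    (x (2 * k + 1) = x 0)%N /\
    ((0 < k)%N -> forall i, G (x i) (x i.+1)).
Proof.
move/eqP/set0Pn => [S]; rewrite addn1 inE => /andP[/andP[S_sub _]].
case/existsP => f /and3P[_ _ /eqP S2].
have val_iter i : val (iter i (@ordS (2 * k).+1) ord0) = (i %% (2 * k).+1)%N.
  elim: i => [|i IHi] /=; first by rewrite mod0n.
  by rewrite IHi -addn1 modnDml addn1.
exists (fun i => f (iter i (@ordS _) ord0)); split=> [|k_gt0 i].
  by congr (f _); apply/val_inj; rewrite val_iter /= modnn.
rewrite -edges_pair; apply: (subsetP S_sub); rewrite -S2.
set j := iter i _ _; apply/imsetP; exists [set j; ordS j]; last first.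
  by rewrite imsetU1 imset_set1.
rewrite edges_pair /= /cycle_adj eqxx andbT.
move: {i}j => j.
apply/eqP => /(congr1 val) /=.
have [lt_j|ge_j] := ltnP j.+1 (2 * k).+1; first by rewrite modn_small //; lia.
have -> : j.+1 = (2 * k).+1 by apply/eqP; rewrite eqn_leq ge_j ltn_ord.
by rewrite modnn; lia.
Qed.
End Copies.

(** * Levels above a neighbourhood and the walks they produce *)

Section Levels.

Variables (R : realFieldType) (T : finType) (G : sgraph T) (a : R).

Definition robust_nbhd (X : {set T}) : {set T} :=
  [set y | a <= #|nbhd G y :&: X|%:R].

Definition level (j : nat) (X : {set T}) : {set T} := iter j robust_nbhd X.

Definition walks_into (j : nat) (X : {set T}) (x : T) : {set j.-tuple T} :=
  [set t : j.-tuple T | path G x t && (last x t \in X)].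

Hypothesis a_ge0 : 0 <= a.

(** Induction on [j]: at least [a] first steps lead into [level j X], and each continues in at least
    [a ^+ j] ways. *)
Lemma card_walks_into j X x :
  x \in level j X -> a ^+ j <= #|walks_into j X x|%:R.
Proof.
elim: j x => [|j IHj] x x_level.
  rewrite expr0 ler1n card_gt0; apply/set0Pn; exists [tuple].
  by rewrite inE.
pose N := nbhd G x :&: level j X.
pose A := [set q : T * j.-tuple T |
  (q.1 \in N) && (q.2 \in walks_into j X q.1)].
have cardA : #|A| = (\sum_(y in N) #|walks_into j X y|)%N.
  under eq_bigr => y _ do rewrite -sum1_card.
  rewrite pair_big_dep /= -sum1_card; apply: eq_bigl => q.
  by rewrite inE.
have le_A : (#|A| <= #|walks_into j.+1 X x|)%N.
  pose F (q : T * j.-tuple T) := cons_tuple q.1 q.2.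
  have F_inj : injective F.
    by move=> [y t] [y' t'] /(congr1 val) [-> /val_inj ->].
  rewrite -(card_imset A F_inj); apply/subset_leq_card/subsetP => w.
  case/imsetP=> -[y t]; rewrite !inE /= => /andP[/andP[Gxy _] ?] ->.
  by rewrite /= Gxy.
apply: le_trans (_ : #|A|%:R <= _); last by rewrite ler_nat.
rewrite cardA natr_sum exprS.
apply: le_trans (_ : \sum_(y in N) a ^+ j <= _); last first.
  by apply: ler_sum => y /setIP[_ /IHj].
rewrite sumr_const -mulr_natl ler_wpM2r ?exprn_ge0 //.
by move: x_level; rewrite /level /= inE.
Qed.

(** Go from [p] along a reversed walk to [x], cross the edge to [y], and return to [p] along a walk
    from [y]. The pieces occupy fixed positions, so the closed walk determines the edge and both
    walks. *)
Lemma card_level_edges K p :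
  #|[set e : T * T | [&& e.1 \in level K (nbhd G p),
      e.2 \in level K (nbhd G p) & G e.1 e.2]]|%:R * a ^+ (2 * K)
    <= #|closed_walks G (K.+1 + K.+1) p|%:R.
Proof.
set L := level K _; set E := [set e | _].
pose W := walks_into K (nbhd G p).
pose A := [set q : (T * T) * (K.-tuple T * K.-tuple T) |
  (q.1 \in E) && (q.2 \in setX (W q.1.1) (W q.1.2))].
have cardA : #|A| = (\sum_(e in E) #|W e.1| * #|W e.2|)%N.
  under eq_bigr => e _ do rewrite -cardsX -sum1_card.
  rewrite pair_big_dep /= -sum1_card; apply: eq_bigl => q.
  by rewrite inE.
have le_A : (#|A| <= #|closed_walks G (K.+1 + K.+1) p|)%N.
  pose F (q : (T * T) * (K.-tuple T * K.-tuple T)) :=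
    cat_tuple (rev_tuple (cons_tuple q.1.1 q.2.1)) (cons_tuple q.1.2 q.2.2).
  have F_inj : injective F.
    move=> [[x y] [t u]] [[x' y'] [t' u']] /(congr1 val) /eqP /=.
    rewrite eqseq_cat ?size_rev /= ?size_tuple //.
    case/andP=> /eqP eq1 /eqP[-> eq2].
    have [-> eq3] := can_inj revK eq1.
    by rewrite (val_inj eq2) (val_inj eq3).
  rewrite -(card_imset A F_inj); apply/subset_leq_card/subsetP => w.
  case/imsetP=> -[[x y] [t u]]; rewrite !inE /=.
  case/andP=> /and3P[_ _ Gxy] /andP[/andP[xt pt] /andP[yu pu]] ->.
  have path_rev : path G p (rev (x :: t)).
    have := rev_path G x (rcons t p).
    rewrite last_rcons belast_rcons => ->; rewrite rcons_path /= pt andbT.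
    by rewrite (eq_path (e' := G)) // => v v'; rewrite adj_sym.
  rewrite /= rcons_cat cat_path path_rev /= rev_cons last_rcons Gxy.
  by rewrite rcons_path yu adj_sym.
apply: le_trans (_ : #|A|%:R <= _); last by rewrite ler_nat.
rewrite cardA natr_sum mulr_natl -sumr_const.
apply: ler_sum => -[x y]; rewrite inE /= => /and3P[xL yL _].
by rewrite natrM mul2n -addnn exprD ler_pM ?exprn_ge0 ?card_walks_into.
Qed.

End Levels.

(** * The covering set and the edge deletion that destroys short odd cycles *)

Section Surgery.

Variables (R : realFieldType) (T : finType) (G : sgraph T).

(** Take [P] maximal among the subsets of [Q] whose neighbourhoods cover at least [b] vertices per
    member: a vertex of [Q] with more than [b] uncovered neighbours could still be added. *)
Lemma cover_by_nbhds (Q : {set T}) (b : R) : 0 <= b ->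
  exists P : {set T},
    [/\ P \subset Q, #|P|%:R * b <= #|T|%:R &
      forall p, p \in Q ->
        #|nbhd G p :\: \bigcup_(q in P) nbhd G q|%:R <= b].
Proof.
move=> b_ge0.
pose cover (P : {set T}) := \bigcup_(q in P) nbhd G q.
pose good (P : {set T}) := (P \subset Q) && (#|P|%:R * b <= #|cover P|%:R).
have [|P /maxsetP[/andP[PQ Pb] P_max]] := @ex_maxset T good.
  by exists set0; rewrite /good sub0set cards0 mul0r ler0n.
exists P; split=> // [|p pQ].
  by apply: le_trans Pb _; rewrite ler_nat max_card.
rewrite leNgt; apply/negP => lt_b.
have p_new : p \notin P.
  apply: contraTN lt_b => pP; rewrite -leNgt.
  have /eqP -> : nbhd G p :\: \bigcup_(q in P) nbhd G q == set0.
    by rewrite setD_eq0 bigcup_sup.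
  by rewrite cards0.
have : p |: P = P.
  apply: P_max; last exact: subsetUr.
  rewrite /good subUset sub1set pQ PQ cardsU1 p_new natrD mulrDl mul1r /=.
  have -> : cover (p |: P) = cover P :|: (nbhd G p :\: cover P).
    by rewrite /cover big_setU1 //= setDE setUIr setUCr setIT setUC.
  rewrite cardsU disjoint_setI0 ?cards0 ?subn0; last first.
    by rewrite -setI_eq0 setIDA setDE -setIA setICA setICr setI0.
  by rewrite natrD addrC lerD // ltW.
by move/setP/(_ p); rewrite setU11 (negPf p_new).
Qed.

(** The relation is oriented, the third case being a step from [x] to [y] that fails to climb;
    [surgery_adj] tests both orientations to restore symmetry. *)
Definition bad_pair (a : R) (K : nat) (Q P : {set T}) : rel T := fun x y =>
  [|| x \notin Q, x \notin \bigcup_(q in P) nbhd G q,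
    [exists q in P, exists j : 'I_K, (x \in level G a j (nbhd G q)) &&
      (y \notin level G a j.+1 (nbhd G q))] |
    [exists q in P, (x \in level G a K (nbhd G q)) &&
      (y \in level G a K (nbhd G q))]].

Definition surgery_adj a K Q P : rel T := fun x y =>
  [&& G x y, ~~ bad_pair a K Q P x y & ~~ bad_pair a K Q P y x].

Lemma surgery_sym a K Q P : symmetric (surgery_adj a K Q P).
Proof. by move=> x y; rewrite /surgery_adj adj_sym [X in _ && X]andbC. Qed.

Lemma surgery_irrefl a K Q P : irreflexive (surgery_adj a K Q P).
Proof. by move=> x; rewrite /surgery_adj adj_irrefl. Qed.

Definition surgery a K Q P : sgraph T :=
  SGraph (@surgery_sym a K Q P) (@surgery_irrefl a K Q P).

Lemma surgery_cycle_free a K Q P k : (0 < k <= K)%N ->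
  cycle_free (2 * k + 1) (surgery a K Q P).
Proof.
case/andP=> k_gt0 k_le; set H := surgery _ _ _ _.
case: (eqVneq (copies (cycle_graph (2 * k + 1)) H) set0) => // /eqP.
case/not_cycle_free_walk => x [x_closed /(_ k_gt0) Hx].
(* The edge from [x 0] to [x 1] survives, so [x 0] is covered; the covering vertex [p] fixes the
   levels used below. *)
have /and3P[_ x01 _] := Hx 0%N.
move: x01; rewrite /bad_pair !negb_or negbK => /and4P[_ x0_cover _ _].
move: x0_cover; rewrite negbK => /bigcupP[p pP x0p].
pose L j := level G a j (nbhd G p).
have climb j u v : (j < K)%N -> H u v -> u \in L j -> v \in L j.+1.
  move=> lt_j /and3P[_ + _] uL; rewrite !negb_or => /and4P[_ _ + _].
  move/existsPn => /(_ p); rewrite pP /= => /existsPn/(_ (Ordinal lt_j)).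
  by rewrite /= uL /= negbK.
have top u v : H u v -> u \in L K -> v \notin L K.
  move=> /and3P[_ + _] uL; rewrite !negb_or => /and4P[_ _ _].
  by move/existsPn => /(_ p); rewrite pP /= uL.
have up j : (j <= k)%N -> x j \in L j.
  elim: j => [//|j IHj] lt_j.
  exact: climb (leq_trans lt_j k_le) (Hx j) (IHj (ltnW lt_j)).
(* Climbs backwards from [x (2 * k + 1)], which is [x 0]; at [j = k] this reaches [x k.+1]. *)
have down j : (j <= k)%N -> x (2 * k + 1 - j)%N \in L j.
  elim: j => [|j IHj] lt_j; first by rewrite subn0 x_closed.
  have := IHj (ltnW lt_j); apply: climb; first exact: leq_trans lt_j k_le.
  rewrite adj_sym; have := Hx (2 * k + 1 - j.+1)%N.
  by congr (H _ (x _)); lia.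
(* Levels need not be nested, so each end of the edge rises by a step from the other end; [minn]
   stops the climb at [K]. *)
have stay i : (x k \in L (minn K (k + i))) /\ (x k.+1 \in L (minn K (k + i))).
  elim: i => [|i [IH1 IH2]].
    rewrite addn0 (minn_idPr k_le); split; first exact: up.
    have -> : k.+1 = (2 * k + 1 - k)%N by lia.
    exact: down.
  have [lt_K|ge_K] := ltnP (k + i) K; last first.
    have -> : minn K (k + i.+1) = minn K (k + i) by lia.
    by split.
  have eq1 : minn K (k + i) = (k + i)%N by lia.
  have -> : minn K (k + i.+1) = (k + i).+1 by lia.
  rewrite eq1 in IH1 IH2; split; last exact: climb lt_K (Hx k) IH1.
  by apply: climb lt_K _ IH2; rewrite adj_sym.
have [] := stay K; have -> : minn K (k + K) = K by lia.
by move=> /(top _ _ (Hx k)) /negP.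
Qed.

End Surgery.

(** * The cost of the surgery *)

Section Distance.

Variables (R : realFieldType) (T : finType) (G : sgraph T).

Lemma card_fibers_le (E : {set T * T}) (c : R) :
  (forall y, #|[set x | (x, y) \in E]|%:R <= c) -> #|E|%:R <= #|T|%:R * c.
Proof.
move=> fib; have -> : #|E| = (\sum_y #|[set x | (x, y) \in E]|)%N.
  rewrite -sum1_card (partition_big snd predT) //=; apply: eq_bigr => y _.
  rewrite -(card_imset _ (f := fun x => (x, y))); last by move=> x x' [].
  rewrite -sum1_card; apply: eq_bigl => -[x z] /=.
  apply/andP/imsetP => [[xzE /eqP <-]|[x']]; first by exists x; rewrite ?inE.
  by rewrite inE => x'y [-> ->].
rewrite natr_sum -[X in _ <= X * c]/(#|predT|%:R) mulr_natl -sumr_const.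
exact: ler_sum.
Qed.

Lemma card_setU_le (A B : {set T * T}) (c d : R) :
  #|A|%:R <= c -> #|B|%:R <= d -> #|A :|: B|%:R <= c + d.
Proof.
move=> Ac Bd; apply: le_trans (lerD Ac Bd).
by rewrite -natrD ler_nat leq_card_setU.
Qed.

Lemma card_bigcup_le (I : finType) (P : {set I}) (F : I -> {set T * T})
    (c : R) :
  (forall i, i \in P -> #|F i|%:R <= c) ->
  #|\bigcup_(i in P) F i|%:R <= #|P|%:R * c.
Proof.
move=> Fc; have -> : #|P|%:R * c = \sum_(i in P) c.
  by rewrite sumr_const mulr_natl.
apply: (big_ind2 (fun (A : {set T * T}) d => #|A|%:R <= d)) => //.
- by rewrite cards0.
- by move=> A c1 B c2; apply: card_setU_le.
Qed.

(** Surgery adds no edge, and every deleted edge has a bad orientation, so the deleted edges lie in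
    the image of the bad ordered pairs. *)
Lemma edit_distance_surgery (a : R) K Q P :
  (edit_distance G (surgery G a K Q P) <=
    #|[set e : T * T | G e.1 e.2 && bad_pair G a K Q P e.1 e.2]|)%N.
Proof.
set B := [set e : T * T | _]; set H := surgery _ _ _ _ _.
apply: leq_trans (leq_imset_card (fun e : T * T => [set e.1; e.2]) B).
apply/subset_leq_card/subsetP => e; rewrite !inE.
case/orP=> /andP[notin /imsetP[[x y]]]; rewrite inE /= => xy eq_e.
- move: notin; rewrite eq_e edges_pair /= /surgery_adj xy /= negb_and !negbK.
  case/orP=> bad_xy; first by apply/imsetP; exists (x, y); rewrite ?inE ?xy.
  by apply/imsetP; exists (y, x); rewrite ?inE 1?setUC //= adj_sym xy.
- by move: notin; rewrite eq_e edges_pair; case/and3P: xy => ->.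
Qed.

(** The terms count pairs meeting [~: Q] (in either coordinate, hence [*+ 2]), pairs with an
    uncovered vertex, failed climbs, and pairs inside a top level. A failed climb at level [j] ends
    at a vertex with fewer than [a] neighbours in that level. *)
Lemma surgery_distance_le (a : R) K (Q P : {set T}) (b w : R) :
  0 < a -> 0 <= b -> P \subset Q ->
  (forall p, p \in Q -> #|nbhd G p :\: \bigcup_(q in P) nbhd G q|%:R <= b) ->
  (forall p, p \in Q -> #|closed_walks G (K.+1 + K.+1) p|%:R <= w) ->
  (edit_distance G (surgery G a K Q P))%:R <=
    #|~: Q|%:R * #|T|%:R *+ 2 + #|T|%:R * b
    + #|P|%:R * (K%:R * (#|T|%:R * a)) + #|P|%:R * (w / a ^+ (2 * K)).
Proof.
move=> a_gt0 b_ge0 /subsetP PQ cover_b walks_w.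
pose C := \bigcup_(q in P) nbhd G q.
pose L j q := level G a j (nbhd G q).
pose B1 : {set T * T} := setX (~: Q) setT :|: setX setT (~: Q).
pose B2 := [set e : T * T | (e.2 \in Q) && (e.1 \in nbhd G e.2 :\: C)].
pose B3 := \bigcup_(q in P) \bigcup_(j in [set: 'I_K])
  [set e : T * T | [&& G e.1 e.2, e.1 \in L j q & e.2 \notin L j.+1 q]].
pose B4 := \bigcup_(q in P)
  [set e : T * T | [&& e.1 \in L K q, e.2 \in L K q & G e.1 e.2]].
apply: le_trans (_ : #|B1 :|: B2 :|: B3 :|: B4|%:R <= _).
  rewrite ler_nat (leq_trans (edit_distance_surgery _ _ _ _)) //.
  apply/subset_leq_card/subsetP => -[x y]; rewrite inE /= => /andP[xy bad].
  (* Pairs with [y] outside [Q] lie in [B1], so [B2] need only treat [y] in [Q], where the covering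
     bound applies. *)
  have [yQ|yQ] := boolP (y \in Q); last first.
    by rewrite !inE /= yQ !orbT.
  case/or4P: bad => [xQ|xC|/existsP[q /andP[qP /existsP[j jxy]]]|].
  - by rewrite !inE /= xQ.
  - by rewrite !in_setU [_ \in B2]inE /= yQ !inE xC adj_sym xy !orbT.
  - rewrite in_setU; apply/orP; left; rewrite in_setU; apply/orP; right.
    apply/bigcupP; exists q => //; apply/bigcupP; exists j => //.
    by rewrite inE /= xy.
  - case/existsP=> q /and3P[qP xL yL]; rewrite in_setU; apply/orP; right.
    by apply/bigcupP; exists q => //; rewrite inE /= /L xL yL.
apply: card_setU_le; first apply: card_setU_le; first apply: card_setU_le.
- rewrite mulr2n; apply: card_setU_le; rewrite cardsX cardsT natrM //.
  by rewrite mulrC.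
- apply: card_fibers_le => y; have [yQ|yQ] := boolP (y \in Q).
    apply: le_trans (cover_b y yQ); rewrite ler_nat subset_leq_card //.
    by apply/subsetP => x; rewrite !inE /= yQ.
  rewrite (_ : [set x | _] = set0) ?cards0 //.
  by apply/setP => x; rewrite !inE /= (negPf yQ).
- apply: card_bigcup_le => q _.
  have <- : #|[set: 'I_K]|%:R = K%:R :> R by rewrite cardsT card_ord.
  apply: card_bigcup_le => j _; apply: card_fibers_le => y.
  have [yL|yL] := boolP (y \in L j.+1 q).
    rewrite (_ : [set x | _] = set0) ?cards0 ?ltW //.
    by apply/setP => x; rewrite in_set0 2!in_set /= yL !andbF.
  move: (yL); rewrite inE -ltNge => /ltW; apply: le_trans.
  rewrite ler_nat subset_leq_card //; apply/subsetP => x.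
  rewrite 2!in_set /= => /and3P[xy xL _].
  by rewrite in_setI xL andbT in_set adj_sym.
- apply: card_bigcup_le => q qP; rewrite ler_pdivlMr ?exprn_gt0 //.
  apply: le_trans (walks_w q (PQ q qP)).
  exact/card_level_edges/ltW.
Qed.

End Distance.

(** * Choice of parameters and the final count *)

Lemma edit_distance_edgeless (T : finType) (G : sgraph T) k : (0 < k)%N ->
  exists2 H : sgraph T, cycle_free (2 * k + 1) H &
    (edit_distance G H <= #|T| ^ 2)%N.
Proof.
move=> k_gt0; pose e : rel T := fun _ _ => false.
have e_sym : symmetric e by [].
have e_irr : irreflexive e by [].
exists (SGraph e_sym e_irr).
  set H := SGraph _ _.
  case: (eqVneq (copies (cycle_graph (2 * k + 1)) H) set0) => // /eqP.
  by case/not_cycle_free_walk => x [_ /(_ k_gt0 0%N)].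
have no_edges : edges (SGraph e_sym e_irr) = set0.
  apply/setP => f; rewrite inE; apply/negbTE/imsetP => -[[x y]].
  by rewrite inE.
rewrite /edit_distance no_edges setD0 set0D setU0.
apply: leq_trans (leq_imset_card _ _) _.
by rewrite -mulnn -card_prod max_card.
Qed.

(* 1/10 and 1/100 are the shares of [eps] left to the exceptional vertices and
   to the edges inside the top levels; [1 / (100 * K.+1)] is [a / (eps^2 n)]. *)
Definition hom_density (R : realType) (K : nat) : R :=
  1000^-1 * (100 * K.+1%:R)^-1 ^+ (2 * K).

Lemma hom_density_gt0 (R : realType) K : 0 < hom_density R K.
Proof. by rewrite mulr_gt0 ?exprn_gt0 ?invr_gt0 ?mulr_gt0 ?ltr0n. Qed.

Lemma far_many_cycle_homs (R : realType) (K k : nat) (eps : R) (T : finType)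
    (G : sgraph T) :
  (0 < k <= K)%N -> 0 < eps -> (0 < #|T|)%N ->
  is_far eps (cycle_free (2 * k + 1) (T := T)) G ->
  hom_density R K * eps ^+ (4 * K + 3) * #|T|%:R ^+ (2 * K + 3)
    <= #|cycle_homs G (2 * K + 3)|%:R.
Proof.
move=> kK eps_gt0 n_gt0 far; set N : R := #|T|%:R.
have N_gt0 : 0 < N by rewrite ltr0n.
pose d : R := (100 * K.+1%:R)^-1.
have d_gt0 : 0 < d by rewrite invr_gt0 mulr_gt0 ?ltr0n.
have Kd : K%:R * d <= 100^-1.
  rewrite /d invfM mulrCA ler_piMr ?invr_ge0 //.
  by rewrite ler_pdivrMr ?ltr0n // mul1r ler_nat.
pose a := d * eps ^+ 2 * N.
pose b := eps * N / 10.
(* Calibrated so that [w / a ^+ (2 * K)], the bound on top-level pairs for each [p], equals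
   [eps ^+ 2 * N ^+ 2 / 100]. *)
pose w := (d * eps ^+ 2) ^+ (2 * K) * eps ^+ 2 / 100 * N ^+ (2 * K + 2).
have a_gt0 : 0 < a by rewrite !mulr_gt0 ?exprn_gt0.
have b_ge0 : 0 <= b by rewrite divr_ge0 // mulr_ge0 ?ltW.
have w_a : w / a ^+ (2 * K) = eps ^+ 2 * N ^+ 2 / 100.
  rewrite /w /a exprD [(_ * N) ^+ _]exprMn; field.
  by rewrite !expf_neq0 // ?mulf_neq0 ?expf_neq0 ?gt_eqF.
pose Q := [set p | #|closed_walks G (K.+1 + K.+1) p|%:R <= w].
(* If there are many exceptional vertices, their closed walks alone suffice; if there are few, the
   surgery costs less than farness allows. *)
have [many|few] := leP (eps * N / 10) #|~: Q|%:R.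
  have -> : (2 * K + 3 = (K.+1 + K.+1).+1)%N by lia.
  apply: le_trans (_ : (\sum_p #|closed_walks G (K.+1 + K.+1) p|)%:R <= _);
    last by rewrite ler_nat sum_closed_walks.
  apply: le_trans (_ : \sum_(p in ~: Q) w <= _); last first.
    rewrite natr_sum [X in _ <= X](bigID [in ~: Q]) /= ler_wpDr ?sumr_ge0 //.
    by apply: ler_sum => p; rewrite !inE -ltNge => /ltW.
  rewrite sumr_const -mulr_natl.
  have w_ge0 : 0 <= w.
    by rewrite !mulr_ge0 ?exprn_ge0 ?invr_ge0 ?mulr_ge0 ?exprn_ge0 ?ltW.
  apply: le_trans (ler_wpM2r w_ge0 many); rewrite le_eqVlt; apply/orP; left.
  apply/eqP; rewrite /w /hom_density -/d.
  have -> : ((K.+1 + K.+1).+1 = (2 * K + 2).+1)%N by lia.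
  have -> : (4 * K + 3 = 2 * (2 * K) + 3)%N by lia.
  rewrite exprMn -exprM exprD [N ^+ _.+1]exprS; by field.
have [P [PQ Pb cover_b]] := cover_by_nbhds G Q b_ge0.
have walks_w p : p \in Q -> #|closed_walks G (K.+1 + K.+1) p|%:R <= w.
  by rewrite inE.
have := surgery_distance_le a_gt0 b_ge0 PQ cover_b walks_w.
have := far _ (surgery_cycle_free G a Q P kK).
rewrite w_a -/N => far_le le_far.
have := le_trans far_le le_far; apply: contra_leT => _.
have eP : #|P|%:R * eps <= 10.
  by rewrite -(ler_pM2r N_gt0); move: Pb; rewrite /b -/N; lra.
have term1 : #|~: Q|%:R * N <= eps * N ^+ 2 / 10.
  have := ler_wpM2r (ltW N_gt0) (ltW few); lra.
have en_gt0 : 0 < eps * N ^+ 2 by rewrite mulr_gt0 ?exprn_gt0.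
have term3 : #|P|%:R * (K%:R * (N * a)) <= eps * N ^+ 2 / 10.
  have -> : #|P|%:R * (K%:R * (N * a))
    = (#|P|%:R * eps) * (K%:R * d) * (eps * N ^+ 2) by rewrite /a; ring.
  rewrite mulrC ler_pM2l //.
  apply: le_trans (_ : 10 * 100^-1 <= _); last by lra.
  by rewrite ler_pM // mulr_ge0 // ltW.
have term4 : #|P|%:R * (eps ^+ 2 * N ^+ 2 / 100) <= eps * N ^+ 2 / 10.
  have := ler_wpM2r (ltW en_gt0) eP; lra.
(* The four shares of [eps * N ^+ 2] are 2/10, 1/10, 1/10 and 1/10, in total one half, which
   contradicts farness. *)
rewrite /b mulr2n; lra.
Qed.

Theorem theorem1p3 (R : realType) (l : nat) :
  exists2 c : R, 0 < c &
    forall (k : nat) (eps : R), (1 <= k)%N -> (k < l)%N -> 0 < eps ->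
    exists n0 : nat, forall (n : nat) (T : finType) (G : sgraph T),
      (n0 <= n)%N -> #|T| = n ->
      is_far eps (cycle_free (2 * k + 1) (T := T)) G ->
      c * eps ^+ (4 * l + 2) * n%:R ^+ (2 * l + 1)
        <= #|copies (cycle_graph (2 * l + 1)) G|%:R.
Proof.
(* For [l = 0] no [k] is admissible. *)
case: l => [|K]; first by exists 1.
set s := (2 * K.+1 + 1)%N; pose S : R := (s ^ s)%:R.
have S_gt0 : 0 < S by rewrite ltr0n expn_gt0 /s addn1.
have dens_gt0 := hom_density_gt0 R K.
(* The factor 2 pays for the non-injective homomorphisms, and [S] for the labellings of one copy. *)
exists (hom_density R K / (2 * S)).
  by rewrite divr_gt0 // mulr_gt0 // ltr0n.
move=> k eps k_gt0 k_lt eps_gt0.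
pose kappa := hom_density R K * eps ^+ (4 * K + 3).
have kappa_gt0 : 0 < kappa by rewrite mulr_gt0 ?exprn_gt0.
(* Beyond this threshold the non-injective maps number at most [kappa / 2 * n%:R ^+ s]; the
   successor ensures [0 < n]. *)
exists (Num.bound (2 * (s * s)%:R / kappa)).+1 => n T G n_big cardT far.
have n_gt0 : (0 < #|T|)%N by rewrite cardT (leq_ltn_trans _ n_big).
have N_gt0 : 0 < n%:R :> R by rewrite -cardT ltr0n.
(* Deleting all edges costs at most [n ^ 2], so farness bounds [eps]. *)
have eps_le1 : eps <= 1.
  have [H freeH] := edit_distance_edgeless G k_gt0.
  rewrite -(ler_nat R) natrX => dist_le.
  have := le_trans (far H freeH) dist_le.
  by rewrite -[X in _ <= X]mul1r ler_pM2r // exprn_gt0 ?ltr0n.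
have many : kappa * n%:R ^+ s <= #|cycle_homs G s|%:R.
  have -> : s = (2 * K + 3)%N by rewrite /s; lia.
  by rewrite -cardT; apply: far_many_cycle_homs far; rewrite ?k_gt0.
have small : (s * s)%:R <= kappa / 2 * n%:R.
  have : 2 * (s * s)%:R / kappa < n%:R.
    apply: lt_le_trans (archi_boundP _) _; last by rewrite ler_nat ltnW.
    by rewrite divr_ge0 ?(ltW kappa_gt0) // mulr_ge0 ?ler0n.
  by rewrite ltr_pdivrMr //; lra.
have hom_le := card_hom_le_copies G s; have ffact_le := ffact_lower n s.
rewrite cardT in hom_le.
have hom_leR : #|cycle_homs G s|%:R + (n ^_ s)%:R
    <= #|copies (cycle_graph s) G|%:R * S + n%:R ^+ s.
  by rewrite -natrX -natrM -!natrD ler_nat.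
have ffact_leR : n%:R * n%:R ^+ s
    <= n%:R * (n ^_ s)%:R + (s * s)%:R * n%:R ^+ s :> R.
  by rewrite -natrX -!natrM -natrD ler_nat.
have copies_ge : kappa / 2 * n%:R ^+ s <= #|copies (cycle_graph s) G|%:R * S.
  rewrite -(ler_pM2l N_gt0).
  have h1 := ler_wpM2l (ltW N_gt0) hom_leR.
  have h2 := ler_wpM2l (ltW N_gt0) many.
  have h3 := ler_wpM2r (exprn_ge0 s (ltW N_gt0)) small.
  lra.
rewrite -(ler_pM2r S_gt0); apply: le_trans copies_ge.
have -> : hom_density R K / (2 * S) * eps ^+ (4 * K.+1 + 2) * n%:R ^+ s * S
    = kappa / 2 * n%:R ^+ s * eps ^+ 3.
  have -> : (4 * K.+1 + 2 = 4 * K + 3 + 3)%N by lia.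
  by rewrite exprD /kappa; field; rewrite gt_eqF.
(* With [l = K.+1] the count above has exponent [4 * l - 1] in [eps]; the spare factor [eps ^+ 3] is
   at most 1. *)
rewrite ler_piMr ?exprn_ile1 ?(ltW eps_gt0) //.
by rewrite mulr_ge0 ?exprn_ge0 ?divr_ge0 ?(ltW kappa_gt0) ?(ltW N_gt0).
Qed.
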